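(* Let $H$ be a Hopf algebra with bijective antipode over a field $k$. Then $Z^2_{NL}(H)\subseteq Z^2_{PL}(H)$; that is, every neat lazy 2-cocycle on $H$ is pure.
   Context: Sweedler notation $\Delta(h)=h_1\otimes h_2$ is used. A linear map $\sigma:H\otimes H\to k$ is written $\sigma(h,h')$. $Reg^2(H)$ is the group (under convolution) of linear maps $\sigma:H\otimes H\to k$ that are convolution invertible and normalized: $\sigma(1,h)=\sigma(h,1)=\varepsilon(h)$. An element $\sigma\in Reg^2(H)$ is - lazy if $\sigma(h_1,h'_1)h_2h'_2=h_1h'_1\sigma(h_2,h'_2)$ for all $h,h'\in H$; - a (left) 2-cocycle if $\sigma(a_1,b_1)\sigma(a_2b_2,c)=\sigma(b_1,c_1)\sigma(a,b_2c_2)$ for all $a,b,c\in H$; - pure if $\sigma(ab_1,c_1)\sigma^{-1}(b_2,c_2)\sigma(b_3,c_3d)=\sigma(b_1,c_1d)\sigma^{-1}(b_2,c_2)\sigma(ab_3,c_3)$ for all $a,b,c,d\in H$, where $\sigma^{-1}$ is the convolution inverse; - neat if $\sigma(a,b_1)\sigma(b_2,c)=\sigma(b_1,c)\sigma(a,b_2)$ for all $a,b,c\in H$. $Z^2_{PL}(H)$ (respectively $Z^2_{NL}(H)$) is the set of $\sigma\in Reg^2(H)$ that are lazy left 2-cocycles and pure (respectively neat). *)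

(* Defs.v *)
From HB Require Import structures.
From mathcomp Require Import all_boot all_order all_algebra.
From mathcomp Require Import finmap.
From mathcomp Require Import boolp classical_sets.
From mathcomp Require Import monalg.

Set Implicit Arguments.
Unset Strict Implicit.
Unset Printing Implicit Defensive.

Import GRing.Theory.
Local Open Scope ring_scope.
Local Open Scope quotient_scope.

Reserved Notation "v ⊗ w" (at level 40, left associativity).

(* MathComp has no tensor product of arbitrary (possibly infinite-dimensional)
   modules. V ⊗ W is built as the free module on V * W modulo the submodule
   tensor_null generated by the bilinearity relations. *)
Section Tensor.
Variables (k : fieldType) (V W : lmodType k).

Inductive tensor_null : {malg k[(V * W)%type]} -> Prop :=
| tensor_null0 : tensor_null 0
| tensor_null_lin c x y :
    tensor_null x -> tensor_null y -> tensor_null (c *: x + y)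
| tensor_null_addl v v' w :
    tensor_null (<< (v + v', w) >> - << (v, w) >> - << (v', w) >>)
| tensor_null_addr v w w' :
    tensor_null (<< (v, w + w') >> - << (v, w) >> - << (v, w') >>)
| tensor_null_scalel c v w :
    tensor_null (<< (c *: v, w) >> - c *: << (v, w) >>)
| tensor_null_scaler c v w :
    tensor_null (<< (v, c *: w) >> - c *: << (v, w) >>).

Definition tensor_nullb (x : {malg k[(V * W)%type]}) : bool := `[< tensor_null x >].

Fact tensor_nullb_closed : zmod_closed tensor_nullb.
Proof.
split; first by apply/asboolP/tensor_null0.
move=> x y /asboolP x0 /asboolP y0; apply/asboolP.
by rewrite -scaleN1r addrC; exact: tensor_null_lin.
Qed.

HB.instance Definition _ :=
  GRing.isZmodClosed.Build {malg k[(V * W)%type]} tensor_nullb tensor_nullb_closed.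

Definition tensor := Quotient.quot (GRing.ZmodClosed.clone _ tensor_nullb _).

HB.instance Definition _ := GRing.Zmodule.on tensor.

Definition tensor_pi : {malg k[(V * W)%type]} -> tensor := \pi_tensor.

Definition tens (v : V) (w : W) : tensor := tensor_pi << (v, w) >>.

Lemma tensor_piP x y : tensor_pi x = tensor_pi y <-> tensor_null (x - y).
Proof.
split=> [/eqP|xy]; last first.
  by apply/eqP; rewrite -Quotient.idealrBE; apply/asboolP.
by rewrite -Quotient.idealrBE => /asboolP.
Qed.

Lemma tensor_piK : cancel repr tensor_pi.
Proof. exact: reprK. Qed.

Lemma tensor_piD : {morph tensor_pi : x y / x + y}.
Proof. by move=> x y; rewrite /tensor_pi !piE. Qed.

Definition tensor_scale (c : k) (t : tensor) : tensor :=
  tensor_pi (c *: repr t).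

Lemma tensor_scale_pi c x : tensor_scale c (tensor_pi x) = tensor_pi (c *: x).
Proof.
apply/tensor_piP; rewrite -scalerBr -[_ *: _]addr0.
apply: tensor_null_lin; last exact: tensor_null0.
by apply/tensor_piP; rewrite tensor_piK.
Qed.

Fact tensor_scaleA c d t :
  tensor_scale c (tensor_scale d t) = tensor_scale (c * d) t.
Proof. by rewrite -[t]tensor_piK !tensor_scale_pi scalerA. Qed.

Fact tensor_scale1 : left_id 1 tensor_scale.
Proof. by move=> t; rewrite -[t]tensor_piK tensor_scale_pi scale1r. Qed.

Fact tensor_scaleDr : right_distributive tensor_scale +%R.
Proof.
move=> c s t; rewrite -[s]tensor_piK -[t]tensor_piK -tensor_piD.
by rewrite !tensor_scale_pi -tensor_piD scalerDr.
Qed.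

Fact tensor_scaleDl t : {morph tensor_scale^~ t : c d / c + d}.
Proof.
by move=> c d; rewrite -[t]tensor_piK !tensor_scale_pi -tensor_piD scalerDl.
Qed.

HB.instance Definition _ := GRing.Zmodule_isLmodule.Build k tensor
  tensor_scaleA tensor_scale1 tensor_scaleDr tensor_scaleDl.

Fact tensor_pi_is_linear : linear tensor_pi.
Proof. by move=> c x y; rewrite tensor_piD -tensor_scale_pi. Qed.

HB.instance Definition _ := GRing.isLinear.Build k {malg k[(V * W)%type]} tensor _
  tensor_pi tensor_pi_is_linear.

End Tensor.

Arguments tensor {k} (V W)%_type_scope.
Notation "V ⊗ W" := (tensor V W) : type_scope.
Notation "v ⊗ w" := (tens v w) : ring_scope.

(* tensor_lift f t = \sum_i f v_i w_i for a representation
   t = \sum_i v_i ⊗ w_i; this is independent of the representation only when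
   f is bilinear. *)
Definition tensor_lift (k : fieldType) (V W : lmodType k) (U : zmodType)
    (f : V -> W -> U) (t : V ⊗ W) : U :=
  \sum_(p <- msupp (repr t)) f ((repr t)@_p *: p.1) p.2.

Section TensorTheory.
Variables (k : fieldType) (V W : lmodType k).

Lemma tensDl (v v' : V) (w : W) : (v + v') ⊗ w = v ⊗ w + v' ⊗ w.
Proof.
rewrite -tensor_piD; apply/tensor_piP; rewrite opprD addrA.
exact: tensor_null_addl.
Qed.

Lemma tensDr (v : V) (w w' : W) : v ⊗ (w + w') = v ⊗ w + v ⊗ w'.
Proof.
rewrite -tensor_piD; apply/tensor_piP; rewrite opprD addrA.
exact: tensor_null_addr.
Qed.

Lemma tensZl c (v : V) (w : W) : (c *: v) ⊗ w = c *: (v ⊗ w).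
Proof.
by rewrite -[RHS]linearZ; apply/tensor_piP; exact: tensor_null_scalel.
Qed.

Lemma tensZr c (v : V) (w : W) : v ⊗ (c *: w) = c *: (v ⊗ w).
Proof.
by rewrite -[RHS]linearZ; apply/tensor_piP; exact: tensor_null_scaler.
Qed.

Lemma tensorE (t : V ⊗ W) :
  t = \sum_(p <- msupp (repr t)) ((repr t)@_p *: p.1) ⊗ p.2.
Proof.
rewrite -[LHS]tensor_piK {1}[repr t]monalgE linear_sum /=.
apply: eq_bigr => -[v w] _ /=; rewrite tensZl -linearZ /=; congr (tensor_pi _).
by apply/malgP => p; rewrite mcoeffZ !mcoeffU mulrnAr mulr1.
Qed.

Variables (U : lmodType k) (f : V -> W -> U).
Hypothesis fl : forall w, linear (f^~ w).
Hypothesis fr : forall v, linear (f v).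

Let F (x : {malg k[(V * W)%type]}) : U := \sum_(p <- msupp x) x@_p *: f p.1 p.2.

Let FE (d : {fset V * W}) x : (msupp x `<=` d)%fset ->
  F x = \sum_(p <- d) x@_p *: f p.1 p.2.
Proof.
move=> xd; rewrite /F (big_fset_incl _ xd) //= => p _ /mcoeff_outdom ->.
by rewrite scale0r.
Qed.

Let F_lin c x y : F (c *: x + y) = c *: F x + F y.
Proof.
pose d := (msupp (c *: x + y) `|` (msupp x `|` msupp y))%fset.
rewrite !(@FE d) ?fsubsetUl //.
- rewrite scaler_sumr -big_split /=; apply: eq_bigr => p _.
  by rewrite mcoeffD mcoeffZ scalerDl scalerA.
- by rewrite /d fsetUA fsubsetUr.
- by rewrite /d fsetUCA fsubsetUl.
Qed.

Let F_U p : F << p >> = f p.1 p.2.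
Proof. by rewrite /F msuppU oner_eq0 big_seq_fset1 mcoeffUU scale1r. Qed.

Let F0 : F 0 = 0. Proof. by rewrite /F msupp0 big_seq_fset0. Qed.

Let FD x y : F (x + y) = F x + F y.
Proof. by rewrite -[x]scale1r F_lin !scale1r. Qed.

Let FZ c x : F (c *: x) = c *: F x.
Proof. by rewrite -[c *: x]addr0 F_lin F0 addr0. Qed.

Let FB x y : F (x - y) = F x - F y.
Proof. by rewrite FD -(scaleN1r y) FZ scaleN1r. Qed.

Let fDl v v' w : f (v + v') w = f v w + f v' w.
Proof. by have := fl w 1 v v'; rewrite !scale1r. Qed.
Let fDr v w w' : f v (w + w') = f v w + f v w'.
Proof. by have := fr v 1 w w'; rewrite !scale1r. Qed.
Let f0l w : f 0 w = 0.
Proof. by apply: (addrI (f 0 w)); rewrite -fDl !addr0. Qed.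
Let f0r v : f v 0 = 0.
Proof. by apply: (addrI (f v 0)); rewrite -fDr !addr0. Qed.
Let fZl c v w : f (c *: v) w = c *: f v w.
Proof. by have := fl w c v 0; rewrite !addr0 f0l addr0. Qed.
Let fZr c v w : f v (c *: w) = c *: f v w.
Proof. by have := fr v c w 0; rewrite !addr0 f0r addr0. Qed.

Let F_null x : tensor_null x -> F x = 0.
Proof.
elim=> {x} [|c x y _ x0 _ y0|v v' w|v w w'|c v w|c v w].
- exact: F0.
- by rewrite F_lin x0 y0 scaler0 addr0.
- by rewrite !FB !F_U /= fDl addrAC addrK subrr.
- by rewrite !FB !F_U /= fDr addrAC addrK subrr.
- by rewrite FB FZ !F_U /= fZl subrr.
- by rewrite FB FZ !F_U /= fZr subrr.
Qed.

Let lift_pi x : tensor_lift f (tensor_pi x) = F x.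
Proof.
have -> : tensor_lift f (tensor_pi x) = F (repr (tensor_pi x)).
  by apply: eq_bigr => p _; rewrite fZl.
apply/eqP; rewrite -subr_eq0 -FB; apply/eqP/F_null/tensor_piP.
exact: tensor_piK.
Qed.

Lemma tensor_lift_tens v w : tensor_lift f (v ⊗ w) = f v w.
Proof. by rewrite lift_pi F_U. Qed.

Lemma tensor_lift_linear : linear (tensor_lift f).
Proof.
move=> c s t; rewrite -[s]tensor_piK -[t]tensor_piK -linearP !lift_pi.
exact: F_lin.
Qed.

End TensorTheory.

Definition tensor_map (k : fieldType) (V W V' W' : lmodType k)
    (f : V -> V') (g : W -> W') : V ⊗ W -> V' ⊗ W' :=
  tensor_lift (fun v w => f v ⊗ g w).

Definition tensor_assoc (k : fieldType) (U V W : lmodType k) :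
    (U ⊗ V) ⊗ W -> U ⊗ (V ⊗ W) :=
  tensor_lift (fun t w => tensor_lift (fun u v => u ⊗ (v ⊗ w)) t).

Definition tensor_mul (k : fieldType) (A B : algType k) (s t : A ⊗ B) : A ⊗ B :=
  tensor_lift (fun a b => tensor_lift (fun a' b' => (a * a') ⊗ (b * b')) t) s.

HB.mixin Record isCoalgebra (k : fieldType) (C : Type)
    of GRing.Lmodule k C := {
  comul : {linear C -> (C ⊗ C)%type};
  counit : {scalar C};
  comulA : forall c : C,
    tensor_assoc (tensor_map comul idfun (comul c))
    = tensor_map idfun comul (comul c);
  counitl : forall c : C, tensor_lift (fun a b => counit a *: b) (comul c) = c;
  counitr : forall c : C, tensor_lift (fun a b => counit b *: a) (comul c) = c
}.

#[short(type="coalgType")]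
HB.structure Definition Coalgebra (k : fieldType) :=
  { C of GRing.Lmodule k C & isCoalgebra k C }.

HB.mixin Record Coalgebra_isBialgebra (k : fieldType) (A : Type)
    of GRing.Algebra k A & Coalgebra k A := {
  comulM : forall x y : A, comul (x * y) = tensor_mul (comul x) (comul y);
  comul1 : comul (1 : A) = 1 ⊗ 1;
  counitM : forall x y : A, counit (x * y) = counit x * counit y;
  counit1 : counit (1 : A) = 1
}.

#[short(type="bialgType")]
HB.structure Definition Bialgebra (k : fieldType) :=
  { A of GRing.Algebra k A & Coalgebra k A & Coalgebra_isBialgebra k A }.

HB.mixin Record Bialgebra_isHopf (k : fieldType) (H : Type)
    of Bialgebra k H := {
  antipode : {linear H -> H};
  antipodel : forall h : H,
    tensor_lift (fun a b => antipode a * b) (comul h) = (counit h)%:A;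
  antipoder : forall h : H,
    tensor_lift (fun a b => a * antipode b) (comul h) = (counit h)%:A
}.

#[short(type="hopfAlgType")]
HB.structure Definition Hopf (k : fieldType) :=
  { H of Bialgebra k H & Bialgebra_isHopf k H }.

(* Sweedler notation: E, an expression linear in each Sweedler variable, is
   evaluated on Δ(h) = h1 ⊗ h2, resp. on
   (id ⊗ Δ)(Δ(h)) = h1 ⊗ h2 ⊗ h3. *)
Notation "'\sw_' ( x , y '<-' h ) E" :=
  (tensor_lift (fun x y => E) (comul h))
  (at level 36, E at level 36, x name, y name, h at level 50) : ring_scope.
Notation "'\sw_' ( x , y , z '<-' h ) E" :=
  (tensor_lift (fun x t => tensor_lift (fun y z => E) (comul t)) (comul h))
  (at level 36, E at level 36, x name, y name, z name, h at level 50)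
  : ring_scope.

Section Cocycles.
Variables (k : fieldType) (H : hopfAlgType k).
Implicit Types (s t : {scalar (H ⊗ H)%type}) (a b c d h : H).

Definition conv s t h h' : k :=
  \sw_(h1, h2 <- h) \sw_(h1', h2' <- h') (s (h1 ⊗ h1') * t (h2 ⊗ h2')).

Definition is_conv_inverse s t : Prop := forall h h',
  conv s t h h' = counit h * counit h' /\
  conv t s h h' = counit h * counit h'.

Definition conv_invertible s : Prop := exists t, is_conv_inverse s t.

(* The value s is a dummy, used only if s is not convolution invertible. *)
Definition conv_inv s : {scalar (H ⊗ H)%type} :=
  if pselect (conv_invertible s) is left ex then projT1 (cid ex) else s.

Lemma conv_invP s : conv_invertible s -> is_conv_inverse s (conv_inv s).
Proof. by rewrite /conv_inv; case: pselect => // ex _; exact: projT2 (cid ex). Qed.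

Definition normalized s : Prop :=
  forall h, s (1 ⊗ h) = counit h /\ s (h ⊗ 1) = counit h.

Definition Reg2 : set {scalar (H ⊗ H)%type} :=
  [set s | conv_invertible s /\ normalized s].

Definition lazy s : Prop := forall h h',
  \sw_(h1, h2 <- h) \sw_(h1', h2' <- h') (s (h1 ⊗ h1') *: (h2 * h2'))
  = \sw_(h1, h2 <- h) \sw_(h1', h2' <- h') (s (h2 ⊗ h2') *: (h1 * h1')).

Definition cocycle2 s : Prop := forall a b c,
  \sw_(a1, a2 <- a) \sw_(b1, b2 <- b) (s (a1 ⊗ b1) * s ((a2 * b2) ⊗ c))
  = \sw_(b1, b2 <- b) \sw_(c1, c2 <- c) (s (b1 ⊗ c1) * s (a ⊗ (b2 * c2))).

Definition pure s : Prop := forall a b c d,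
  \sw_(b1, b2, b3 <- b) \sw_(c1, c2, c3 <- c)
    (s ((a * b1) ⊗ c1) * conv_inv s (b2 ⊗ c2) * s (b3 ⊗ (c3 * d)))
  = \sw_(b1, b2, b3 <- b) \sw_(c1, c2, c3 <- c)
    (s (b1 ⊗ (c1 * d)) * conv_inv s (b2 ⊗ c2) * s ((a * b3) ⊗ c3)).

Definition neat s : Prop := forall a b c,
  \sw_(b1, b2 <- b) (s (a ⊗ b1) * s (b2 ⊗ c))
  = \sw_(b1, b2 <- b) (s (b1 ⊗ c) * s (a ⊗ b2)).

Definition Z2L : set {scalar (H ⊗ H)%type} :=
  [set s | Reg2 s /\ lazy s /\ cocycle2 s].

Definition Z2PL : set {scalar (H ⊗ H)%type} := [set s | Z2L s /\ pure s].

Definition Z2NL : set {scalar (H ⊗ H)%type} := [set s | Z2L s /\ neat s].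

End Cocycles.

(* Main.v *)
(* Forms in a, b, c, d under convolution make up a ring. Write x = σ(a,b),
   y = σ(b,c), z = σ(c,d), p = σ(ab,c), q = σ(a,bc), r = σ(bc,d), t = σ(b,cd),
   each extended by ε in the missing variables. The cocycle identity gives
   x p = y q and y r = z t; laziness gives that x commutes with p; neatness, also
   applied to the products ab, bc, cd, gives that the pairs (x,y), (y,z), (q,r),
   (p,z), (x,t) commute, and (x,z) commutes trivially. Hence x and z commute with
   q and r, so y^-1 t = z^-1 r and y^-1 p = x^-1 q commute, and
   p y^-1 t = y (x^-1 q)(z^-1 r) = y (z^-1 r)(x^-1 q) = t y^-1 p,
   which is purity. The ring is realised by iterating A |-> Hom(H, A) with its
   convolution product, starting from A = k. *)
From HB Require Import structures.
Require Import Defs.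
From mathcomp Require Import all_boot all_order all_algebra.
From mathcomp Require Import boolp.
From mathcomp Require Import classical_sets.

Set Implicit Arguments.
Unset Strict Implicit.
Unset Printing Implicit Defensive.

Import GRing.Theory.
Local Open Scope ring_scope.

(** * Maps out of tensor products *)

Section TensorLift.
Variables (k : fieldType) (V W : lmodType k).

(** [tensor_lift] is a finite sum over a chosen representative of [t], and additive maps pass
    through finite sums. *)
Lemma tensor_lift_comp (U U' : zmodType) (phi : {additive U -> U'})
    (f : V -> W -> U) t :
  phi (tensor_lift f t) = tensor_lift (fun v w => phi (f v w)) t.
Proof. exact: raddf_sum. Qed.

Lemma tensor_lift_compl (U U' : lmodType k) (phi : U -> U') (f : V -> W -> U) t :
  linear phi -> phi (tensor_lift f t) = tensor_lift (fun v w => phi (f v w)) t.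
Proof.
move=> phil.
pose p : {linear U -> U'} := HB.pack phi (GRing.isLinear.Build k U U' _ phi phil).
exact: (tensor_lift_comp p).
Qed.

Lemma eq_tensor_lift (U : zmodType) (f g : V -> W -> U) t :
  (forall v w, f v w = g v w) -> tensor_lift f t = tensor_lift g t.
Proof. by move=> fg; apply: eq_bigr => p _; exact: fg. Qed.

Lemma tensor_lift_linear_param (M U : lmodType k) (f : M -> V -> W -> U) t :
  (forall v w, linear (fun x => f x v w)) -> linear (fun x => tensor_lift (f x) t).
Proof.
move=> fl c x y; rewrite /tensor_lift scaler_sumr -big_split.
by apply: eq_bigr => p _; exact: fl.
Qed.

End TensorLift.

(** * Coassociativity in Sweedler form *)

Section Coassociativity.
Variables (k : fieldType) (C : coalgType k) (A : lmodType k).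
Variable F : C -> C -> C -> A.
Hypothesis F1 : forall y z, linear (fun x => F x y z).
Hypothesis F2 : forall x z, linear (fun y => F x y z).
Hypothesis F3 : forall x y, linear (F x y).

(** Linearity in each variable makes the sums independent of the representatives chosen by
    [tensor_lift], so the tensor identity [comulA] can be transported along [F]. *)
Lemma comul_coassoc h :
  \sw_(x, z <- h) \sw_(x1, x2 <- x) F x1 x2 z
  = \sw_(x, y, z <- h) F x y z.
Proof.
(* [G] is the linear map on C ⊗ (C ⊗ C) induced by [F]; it is applied to both sides of [comulA]. *)
pose G := tensor_lift (fun x t => tensor_lift (F x) t).
have Gl : linear G.
  apply: tensor_lift_linear => [t|x]; last exact: tensor_lift_linear.
  by apply: tensor_lift_linear_param => y z; exact: F1.
have Gt x t : G (x ⊗ t) = tensor_lift (F x) t.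
  rewrite /G tensor_lift_tens // => *; last exact: tensor_lift_linear.
  by apply: tensor_lift_linear_param => y z; exact: F1.
have al (z : C) : linear (fun t => tensor_lift (fun u v : C => u ⊗ (v ⊗ z)) t).
  apply: tensor_lift_linear => [v|u] c u1 u2.
    by rewrite tensDl tensZl.
  by rewrite tensDl tensZl tensDr tensZr.
have ar t : linear (fun z : C => tensor_lift (fun u v : C => u ⊗ (v ⊗ z)) t).
  by apply: tensor_lift_linear_param => u v c z1 z2; rewrite !(tensDr, tensZr).
have assl : linear (@tensor_assoc k C C C) by apply: tensor_lift_linear.
have := congr1 G (comulA h).
rewrite /tensor_map.
rewrite (tensor_lift_compl _ _ assl) !(tensor_lift_compl _ _ Gl) => E.
transitivity (tensor_lift (fun v w : C => G (tensor_assoc (comul v ⊗ w)))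
                (comul h)).
  apply: eq_tensor_lift => x z.
  rewrite /tensor_assoc tensor_lift_tens // (tensor_lift_compl _ _ Gl).
  apply: eq_tensor_lift => x1 x2.
  by rewrite Gt tensor_lift_tens.
rewrite E; apply: eq_tensor_lift => x t; rewrite Gt.
exact: eq_tensor_lift.
Qed.

End Coassociativity.

(** * The convolution algebra Hom(H, A) *)

Section ConvolutionAlgebra.
Variables (k : fieldType) (H : bialgType k) (A : algType k).

(** A type of its own, so that its product can be convolution. The result is again an algebra over
    k, so the construction iterates and yields curried multilinear forms. *)
Record convalg := ConvAlg { conv_fun :> H -> A; convalg_linear : linear conv_fun }.

HB.instance Definition _ (f : convalg) :=
  GRing.isLinear.Build k H A _ (conv_fun f) (@convalg_linear f).

Lemma convalgP (f g : convalg) : f =1 g -> f = g.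
Proof.
case: f g => [f fl] [g gl] /= /funext fg; rewrite fg in fl *.
by rewrite (Prop_irrelevance fl gl).
Qed.

HB.instance Definition _ := gen_eqMixin convalg.
HB.instance Definition _ := gen_choiceMixin convalg.

Fact conv0_linear : linear (fun _ : H => 0 : A).
Proof. by move=> c x y; rewrite scaler0 addr0. Qed.
Fact convD_linear (f g : convalg) : linear (fun x => f x + g x).
Proof. by move=> c x y; rewrite !linearP scalerDr addrACA. Qed.
Fact convN_linear (f : convalg) : linear (fun x => - f x).
Proof. by move=> c x y; rewrite linearP opprD scalerN. Qed.
Fact convZ_linear d (f : convalg) : linear (fun x => d *: f x).
Proof. by move=> c x y; rewrite linearP scalerDr !scalerA mulrC. Qed.

Definition conv0 := ConvAlg conv0_linear.
Definition convD f g := ConvAlg (convD_linear f g).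
Definition convN f := ConvAlg (convN_linear f).
Definition convZ d f := ConvAlg (convZ_linear d f).

Fact convDA : associative convD.
Proof. by move=> f g h; apply: convalgP => x /=; rewrite addrA. Qed.
Fact convDC : commutative convD.
Proof. by move=> f g; apply: convalgP => x /=; rewrite addrC. Qed.
Fact conv0D : left_id conv0 convD.
Proof. by move=> f; apply: convalgP => x /=; rewrite add0r. Qed.
Fact convND : left_inverse conv0 convN convD.
Proof. by move=> f; apply: convalgP => x /=; rewrite addNr. Qed.

HB.instance Definition _ := GRing.isZmodule.Build convalg convDA convDC conv0D convND.

Fact convZA c d f : convZ c (convZ d f) = convZ (c * d) f.
Proof. by apply: convalgP => x /=; rewrite scalerA. Qed.
Fact conv1Z : left_id 1 convZ.
Proof. by move=> f; apply: convalgP => x /=; rewrite scale1r. Qed.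
Fact convZDr : right_distributive convZ +%R.
Proof. by move=> c f g; apply: convalgP => x /=; rewrite scalerDr. Qed.
Fact convZDl f : {morph convZ^~ f : c d / c + d}.
Proof. by move=> c d; apply: convalgP => x /=; rewrite scalerDl. Qed.

HB.instance Definition _ := GRing.Zmodule_isLmodule.Build k convalg
  convZA conv1Z convZDr convZDl.

Fact conv_mul_bilinearl (f g : convalg) y : linear (fun x => f x * g y).
Proof. by move=> c x1 x2; rewrite linearP mulrDl scalerAl. Qed.
Fact conv_mul_bilinearr (f g : convalg) x : linear (fun y => f x * g y).
Proof. by move=> c x1 x2; rewrite linearP mulrDr scalerAr. Qed.

Fact convM_linear (f g : convalg) : linear (fun h => \sw_(x, y <- h) (f x * g y)).
Proof.
by move=> c x y; rewrite linearP; apply: tensor_lift_linear => ?;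
  [exact: conv_mul_bilinearl|exact: conv_mul_bilinearr].
Qed.
Fact convalg_const_linear (a : A) : linear (fun h : H => counit h *: a).
Proof. by move=> c x y; rewrite linearP scalerDl scalerA. Qed.

Definition convM f g := ConvAlg (convM_linear f g).
(** The embedding of A into Hom(H, A) that extends a form by ε in a new first variable. *)
Definition convalg_const a := ConvAlg (convalg_const_linear a).
Definition conv1 := convalg_const 1.

(** Both bracketings equal the triple Sweedler sum, by coassociativity. *)
Fact convMA : associative convM.
Proof.
move=> f g h; apply: convalgP => x /=.
transitivity (\sw_(a, b, c <- x) (f a * g b * h c)).
  apply: eq_tensor_lift => a t.
  rewrite (tensor_lift_compl (phi := fun z => f a * z)) => [|c u v]; last first.
    by rewrite mulrDr scalerAr.
  by apply: eq_tensor_lift => b c; rewrite mulrA.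
rewrite -comul_coassoc.
- apply: eq_tensor_lift => a c.
  by rewrite (tensor_lift_compl (phi := fun z => z * h c)) // => d u v;
    rewrite mulrDl scalerAl.
- by move=> b c d u v; rewrite linearP !mulrDl -!scalerAl.
- by move=> b c d u v; rewrite linearP mulrDr mulrDl -scalerAr -scalerAl.
- by move=> b c d u v; rewrite linearP mulrDr -scalerAr.
Qed.

Fact conv1M : left_id conv1 convM.
Proof.
move=> f; apply: convalgP => x /=; rewrite -[in RHS](counitl x).
rewrite tensor_lift_comp; apply: eq_tensor_lift => a b.
by rewrite -scalerAl mul1r /= linearZ.
Qed.

Fact convM1 : right_id conv1 convM.
Proof.
move=> f; apply: convalgP => x /=; rewrite -[in RHS](counitr x).
rewrite tensor_lift_comp; apply: eq_tensor_lift => a b.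
by rewrite -scalerAr mulr1 /= linearZ.
Qed.

Fact convMDl : left_distributive convM +%R.
Proof.
move=> f g h; apply: convalgP => x /=; rewrite /tensor_lift -big_split.
by apply: eq_bigr => p _; exact: mulrDl.
Qed.

Fact convMDr : right_distributive convM +%R.
Proof.
move=> f g h; apply: convalgP => x /=; rewrite /tensor_lift -big_split.
by apply: eq_bigr => p _; exact: mulrDr.
Qed.

Fact conv1_neq0 : conv1 != 0.
Proof.
apply/eqP => /(congr1 (fun f : convalg => f 1)) /= /eqP.
by rewrite counit1 scale1r oner_eq0.
Qed.

HB.instance Definition _ := GRing.Zmodule_isNzRing.Build convalg
  convMA conv1M convM1 convMDl convMDr conv1_neq0.

Fact convZAl c (f g : convalg) : c *: (f * g) = (c *: f) * g.
Proof.
apply: convalgP => x /=; rewrite /tensor_lift scaler_sumr.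
by apply: eq_bigr => p _; rewrite -scalerAl.
Qed.

HB.instance Definition _ := GRing.Lmodule_isLalgebra.Build k convalg convZAl.

Fact convZAr c (f g : convalg) : c *: (f * g) = f * (c *: g).
Proof.
apply: convalgP => x /=; rewrite /tensor_lift scaler_sumr.
by apply: eq_bigr => p _; rewrite -scalerAr.
Qed.

HB.instance Definition _ := GRing.Lalgebra_isAlgebra.Build k convalg convZAr.

Lemma convME (f g : convalg) h : (f * g) h = \sw_(x, y <- h) (f x * g y).
Proof. by []. Qed.

End ConvolutionAlgebra.

Arguments convalg_const {k} H {A} a.

(** * Algebra morphisms between convolution algebras *)

Section ConvolutionAlgebraMaps.
Variables (k : fieldType) (H : bialgType k).

Lemma convM3E (A : algType k) (f g h : convalg H A) x :
  (f * (g * h)) x = \sw_(a, b, c <- x) (f a * (g b * h c)).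
Proof.
apply: eq_tensor_lift => a t.
rewrite (tensor_lift_compl (phi := fun z => f a * z)) // => c u v.
by rewrite mulrDr scalerAr.
Qed.

Lemma tensor_lift_conv_fun (A : algType k) (V W : lmodType k)
    (F : V -> W -> convalg H A) t x :
  tensor_lift F t x = tensor_lift (fun v w => F v w x) t.
Proof. exact: (tensor_lift_compl (phi := fun f : convalg H A => f x)). Qed.

Lemma convM2E (A : algType k) (f g : convalg H (convalg H A)) x y :
  (f * g) x y = \sw_(x1, x2 <- x) \sw_(y1, y2 <- y) (f x1 y1 * g x2 y2).
Proof. exact: tensor_lift_conv_fun. Qed.

(** The counit axiom absorbs the factor ε. This lemma and its right-hand twin remove the coproduct
    of a variable in which one factor is merely ε. *)
Lemma convalg_constMl (A : algType k) (a : A) (f : convalg H A) x :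
  (convalg_const H a * f) x = a * f x.
Proof.
have fl : linear (fun y => a * f y).
  by move=> c u v; rewrite linearP mulrDr scalerAr.
rewrite -[in RHS](counitl x) (tensor_lift_compl _ _ fl).
by apply: eq_tensor_lift => u v; rewrite /= linearZ -scalerAl -scalerAr.
Qed.

Lemma convalg_constMr (A : algType k) (a : A) (f : convalg H A) x :
  (f * convalg_const H a) x = f x * a.
Proof.
have fl : linear (fun y => f y * a).
  by move=> c u v; rewrite linearP mulrDl scalerAl.
rewrite -[in RHS](counitr x) (tensor_lift_compl _ _ fl).
by apply: eq_tensor_lift => u v; rewrite /= linearZ -scalerAl -scalerAr.
Qed.

Section Const.
Variable A : algType k.

Fact convalg_const_is_linear : linear (@convalg_const k H A).
Proof.
by move=> c a b; apply: convalgP => x /=; rewrite scalerDr !scalerA mulrC.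
Qed.

Fact convalg_const_is_monoid_morphism : monoid_morphism (@convalg_const k H A).
Proof.
split=> [|a b]; apply: convalgP => x //.
by rewrite convalg_constMl /= scalerAr.
Qed.

HB.instance Definition _ := GRing.isLinear.Build k A (convalg H A) _
  (@convalg_const k H A) convalg_const_is_linear.
HB.instance Definition _ := GRing.isMonoidMorphism.Build A (convalg H A)
  (@convalg_const k H A) convalg_const_is_monoid_morphism.

End Const.

Section Map.
Variables (A B : algType k) (phi : {lrmorphism A -> B}).

Fact convalg_map_fun_linear (f : convalg H A) : linear (fun x => phi (f x)).
Proof. by move=> c x y; rewrite !linearP. Qed.

(** Functoriality of Hom(H, -): the first variable is left alone and [phi] acts on the form in the
    remaining ones. *)
Definition convalg_map f : convalg H B := ConvAlg (convalg_map_fun_linear f).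

Fact convalg_map_is_linear : linear convalg_map.
Proof. by move=> c f g; apply: convalgP => x /=; rewrite linearP. Qed.

Fact convalg_map_is_monoid_morphism : monoid_morphism convalg_map.
Proof.
split=> [|f g]; apply: convalgP => x /=; first by rewrite linearZ rmorph1.
rewrite tensor_lift_comp; apply: eq_tensor_lift => u v.
by rewrite /= rmorphM.
Qed.

HB.instance Definition _ := GRing.isLinear.Build k (convalg H A) (convalg H B) _
  convalg_map convalg_map_is_linear.
HB.instance Definition _ :=
  GRing.isMonoidMorphism.Build (convalg H A) (convalg H B)
    convalg_map convalg_map_is_monoid_morphism.

Lemma convalg_map_const a : convalg_map (convalg_const H a) = convalg_const H (phi a).
Proof. by apply: convalgP => x /=; rewrite linearZ. Qed.

End Map.

Section Comul.
Variable A : algType k.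

Fact convalg_mulin_fun_linear (f : convalg H A) x : linear (fun y => f (x * y)).
Proof. by move=> c y z; rewrite mulrDr -scalerAr linearP. Qed.

Fact convalg_mulin_linear (f : convalg H A) :
  linear (fun x => ConvAlg (convalg_mulin_fun_linear f x)).
Proof.
by move=> c y z; apply: convalgP => x /=; rewrite mulrDl -scalerAl linearP.
Qed.

(** Pullback along the multiplication of H: the first variable x is replaced by a product xy of two
    variables. *)
Definition convalg_mulin f : convalg H (convalg H A) :=
  ConvAlg (convalg_mulin_linear f).

Fact convalg_mulin_is_linear : linear convalg_mulin.
Proof. by move=> c f g; do 2!apply: convalgP => ?. Qed.

(** Here the bialgebra axioms enter: [counitM] gives the unit and [comulM] the product. *)
Fact convalg_mulin_is_monoid_morphism : monoid_morphism convalg_mulin.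
Proof.
split=> [|f g]; apply: convalgP => x; apply: convalgP => y.
  by rewrite /= counitM scalerA.
have fgl : linear (tensor_lift (fun u v => f u * g v)).
  apply: tensor_lift_linear => u.
    exact: conv_mul_bilinearl.
  exact: conv_mul_bilinearr.
rewrite convM2E /= comulM (tensor_lift_compl _ _ fgl).
apply: eq_tensor_lift => x1 x2; rewrite (tensor_lift_compl _ _ fgl).
apply: eq_tensor_lift => y1 y2; rewrite tensor_lift_tens // => u.
  exact: conv_mul_bilinearl.
exact: conv_mul_bilinearr.
Qed.

HB.instance Definition _ :=
  GRing.isLinear.Build k (convalg H A) (convalg H (convalg H A)) _
    convalg_mulin convalg_mulin_is_linear.
HB.instance Definition _ :=
  GRing.isMonoidMorphism.Build (convalg H A) (convalg H (convalg H A))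
    convalg_mulin convalg_mulin_is_monoid_morphism.

Lemma convalg_mulin_const a :
  convalg_mulin (convalg_const H a) = convalg_const H (convalg_const H a).
Proof.
by apply: convalgP => x; apply: convalgP => y; rewrite /= counitM scalerA.
Qed.

End Comul.

End ConvolutionAlgebraMaps.

Arguments convalg_mulin {k H A} f.

(** * Purity as a consequence of commutation relations in a ring *)

Section CommutingRelations.
Variable R : pzRingType.

Lemma commr_inv (x x' w : R) :
  x * x' = 1 -> x' * x = 1 -> GRing.comm x w -> GRing.comm x' w.
Proof.
by move=> xx' x'x xw; rewrite /GRing.comm -[LHS]mulr1 -xx' mulrA
  -(mulrA x') -xw mulrA x'x mul1r.
Qed.

Lemma commuting_cocycle_relation (x x' y y' z z' p q r t : R) :
    x * x' = 1 -> x' * x = 1 -> y * y' = 1 -> y' * y = 1 ->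
    z * z' = 1 -> z' * z = 1 ->
    x * p = y * q -> y * r = z * t ->
    GRing.comm x y -> GRing.comm y z -> GRing.comm x z -> GRing.comm x p ->
    GRing.comm q r -> GRing.comm p z -> GRing.comm x t ->
  p * (y' * t) = t * (y' * p).
Proof.
move=> xx' x'x yy' y'y zz' z'z xp yr xy yz xz cxp qr pz xt.
have qE : q = y' * (x * p) by rewrite xp mulrA y'y mul1r.
have rE : r = y' * (z * t) by rewrite -yr mulrA y'y mul1r.
have y'x := commr_inv yy' y'y (commr_sym xy).
have y'z := commr_inv yy' y'y yz.
(* Each of x and z commutes with all factors of q = y' x p, and x with all factors of r = y' z t. *)
have qx : GRing.comm q x.
  rewrite qE; apply/commr_sym/commrM; first exact/commr_sym.
  by apply: commrM; first exact: commr_refl.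
have qz : GRing.comm q z.
  rewrite qE; apply/commr_sym/commrM; first exact/commr_sym.
  by apply: commrM; exact/commr_sym.
have rx : GRing.comm r x.
  rewrite rE; apply/commr_sym/commrM; first exact/commr_sym.
  exact: commrM.
have x'q := commr_inv xx' x'x (commr_sym qx).
have x'r := commr_inv xx' x'x (commr_sym rx).
have z'q := commr_inv zz' z'z (commr_sym qz).
have x'z' := commr_sym (commr_inv zz' z'z (commr_sym (commr_inv xx' x'x xz))).
(* x' is moved past y to make x p = y q applicable; likewise z' for t. *)
have pE : p = y * (x' * q).
  by rewrite mulrA -(commr_inv xx' x'x xy) -mulrA -xp mulrA x'x mul1r.
have tE : t = y * (z' * r).
  rewrite mulrA -(commr_inv zz' z'z (commr_sym yz)) -mulrA yr.
  by rewrite mulrA z'z mul1r.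
have -> : y' * t = z' * r by rewrite tE mulrA y'y mul1r.
have -> : y' * p = x' * q by rewrite pE mulrA y'y mul1r.
rewrite pE tE -!(mulrA y); congr (y * _).
by apply: commrM; apply/commr_sym/commrM.
Qed.

End CommutingRelations.

(** * Cocycle, laziness and neatness conditions as relations between forms *)

Section CocycleRelations.
Variables (k : fieldType) (H : hopfAlgType k).
Implicit Types (s t : {scalar (H ⊗ H)%type}).

(** [E1] to [E4] hold the curried forms on H in one to four variables; [k^o] is k as an algebra over
    itself. *)
Local Notation E1 := (convalg H k^o).
Local Notation E2 := (convalg H E1).
Local Notation E3 := (convalg H E2).
Local Notation E4 := (convalg H E3).
Local Notation cst := (convalg_const H).

Fact curry_form_fun_linear s a : linear (fun b => s (a ⊗ b) : k^o).
Proof. by move=> c x y; rewrite tensDr tensZr linearP. Qed.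

Fact curry_form_linear s : linear (fun a => ConvAlg (curry_form_fun_linear s a)).
Proof.
by move=> c x y; apply: convalgP => b /=; rewrite tensDl tensZl linearP.
Qed.

Definition curry_form s : E2 := ConvAlg (curry_form_linear s).

Lemma curry_form_inverse s t : is_conv_inverse s t ->
  curry_form s * curry_form t = 1 /\ curry_form t * curry_form s = 1.
Proof.
move=> st; split; apply: convalgP => a; apply: convalgP => b;
  rewrite convM2E /=; have [stE tsE] := st a b.
- by rewrite [LHS]stE [LHS]mulrC -[RHS]/(counit a * (counit b * 1)) mulr1 mulrC.
- by rewrite [LHS]tsE [LHS]mulrC -[RHS]/(counit a * (counit b * 1)) mulr1 mulrC.
Qed.

(** At (a, b, c) these four forms are σ(a,b)ε(c), ε(a)σ(b,c), σ(ab,c) and σ(a,bc): the letters x, y,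
    p, q of the overview, before d is added. *)
Definition form12 s : E3 := convalg_map (convalg_map cst) (curry_form s).
Definition form23 s : E3 := cst (curry_form s).
Definition form12_3 s : E3 := convalg_mulin (curry_form s).
Definition form1_23 s : E3 := convalg_map convalg_mulin (curry_form s).

Lemma cocycle_relation s : cocycle2 s ->
  form12 s * form12_3 s = form23 s * form1_23 s.
Proof.
move=> cs; apply: convalgP => a; apply: convalgP => b; apply: convalgP => c.
rewrite convM2E convalg_constMl convM2E tensor_lift_conv_fun.
transitivity (\sw_(a1, a2 <- a) \sw_(b1, b2 <- b)
    (s (a1 ⊗ b1) * s ((a2 * b2) ⊗ c))); last exact: cs.
apply: eq_tensor_lift => a1 a2; rewrite tensor_lift_conv_fun.
by apply: eq_tensor_lift => b1 b2; rewrite convalg_constMl.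
Qed.

(** One factor is ε in a and the other is ε in c, so only the coproduct of b survives. *)
Lemma neat_relation s : neat s -> GRing.comm (form12 s) (form23 s).
Proof.
move=> ns; apply: convalgP => a; apply: convalgP => b; apply: convalgP => c.
rewrite convalg_constMr convalg_constMl !convME !tensor_lift_conv_fun.
transitivity (\sw_(b1, b2 <- b) (s (a ⊗ b1) * s (b2 ⊗ c))).
  by apply: eq_tensor_lift => b1 b2; rewrite convalg_constMl.
rewrite ns; apply: eq_tensor_lift => b1 b2; rewrite convalg_constMr.
by [].
Qed.

(** The laziness identity lives in H; the linear functional h ↦ σ(h,c) turns it into an identity of
    forms. *)
Lemma lazy_relation s : lazy s -> GRing.comm (form12 s) (form12_3 s).
Proof.
move=> ls; apply: convalgP => a; apply: convalgP => b; apply: convalgP => c.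
have sl : linear (fun h => curry_form s h c).
  by move=> d x y; rewrite linearP.
rewrite !convM2E !tensor_lift_conv_fun.
(* [L] pulls that functional out of the double Sweedler sum. *)
have L F : \sw_(a1, a2 <- a) \sw_(b1, b2 <- b)
      (curry_form s (F a1 a2 b1 b2) c : k^o)
    = curry_form s (\sw_(a1, a2 <- a) \sw_(b1, b2 <- b) F a1 a2 b1 b2) c.
  rewrite (tensor_lift_compl _ _ sl); apply: eq_tensor_lift => a1 a2.
  by rewrite (tensor_lift_compl _ _ sl).
transitivity (curry_form s (\sw_(a1, a2 <- a) \sw_(b1, b2 <- b)
    (s (a1 ⊗ b1) *: (a2 * b2))) c); last rewrite ls; rewrite -L;
  apply: eq_tensor_lift => a1 a2; rewrite tensor_lift_conv_fun;
  apply: eq_tensor_lift => b1 b2.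
- by rewrite convalg_constMl /= tensZl linearZ.
- by rewrite convalg_constMr /= tensZl linearZ /= [RHS]mulrC.
Qed.

(* The two embeddings of forms in three variables into forms in (a, b, c, d):
   lift4 uses (a, b, c), and cst uses (b, c, d). *)
Local Notation lift4 := (convalg_map (convalg_map (convalg_map cst)) : E3 -> E4).

(** Evaluated at a and b, the first form is a scalar multiple of 1 in [E2], hence central. *)
Lemma form12_form34_comm s : GRing.comm (lift4 (form12 s)) (cst (form23 s)).
Proof.
apply: convalgP => a; rewrite convalg_constMl convalg_constMr.
apply: convalgP => b; rewrite convalg_constMl convalg_constMr.
have -> : lift4 (form12 s) a b = (s (a ⊗ b))%:A.
  apply: convalgP => c; apply: convalgP => d.
  rewrite -[LHS]/(counit d * (counit c * s (a ⊗ b))).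
  rewrite -[RHS]/(s (a ⊗ b) * (counit c * (counit d * 1))).
  by rewrite mulr1 mulrCA mulrA mulrC.
by rewrite -scalerAl -scalerAr mul1r mulr1.
Qed.

(** The image of [neat_relation] under the algebra morphism that substitutes a product for the first
    variable: the pair (p, z). The next two lemmas substitute in the second and third variables, for
    (q, r) and (x, t). *)
Lemma neat_relation_mul1 s : neat s ->
  GRing.comm (lift4 (form12_3 s)) (cst (form23 s)).
Proof.
move=> /neat_relation/(congr1 convalg_mulin); rewrite !rmorphM /=.
have -> : convalg_mulin (form12 s) = lift4 (form12_3 s).
  by do 4!apply: convalgP => ?.
by rewrite /form23 convalg_mulin_const.
Qed.

Lemma neat_relation_mul2 s : neat s ->
  GRing.comm (lift4 (form1_23 s)) (cst (form12_3 s)).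
Proof.
move=> /neat_relation/(congr1 (convalg_map convalg_mulin)); rewrite !rmorphM /=.
have -> : convalg_map convalg_mulin (form12 s) = lift4 (form1_23 s).
  by do 4!apply: convalgP => ?.
by rewrite /form23 convalg_map_const.
Qed.

Lemma neat_relation_mul3 s : neat s ->
  GRing.comm (lift4 (form12 s)) (cst (form1_23 s)).
Proof.
move=> /neat_relation/(congr1 (convalg_map (convalg_map convalg_mulin))).
rewrite !rmorphM /=.
have -> : convalg_map (convalg_map convalg_mulin) (form12 s) = lift4 (form12 s).
  apply: convalgP => a; apply: convalgP => b.
  by rewrite /= convalg_mulin_const convalg_map_const.
by rewrite /form23 convalg_map_const.
Qed.

Lemma pure_relation s t : is_conv_inverse s t ->
  lazy s -> cocycle2 s -> neat s ->
  lift4 (form12_3 s) * (lift4 (form23 t) * cst (form1_23 s))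
  = cst (form1_23 s) * (lift4 (form23 t) * lift4 (form12_3 s)).
Proof.
move=> /curry_form_inverse[st ts] ls cs ns.
have form23M u v : curry_form u * curry_form v = 1 -> form23 u * form23 v = 1.
  by move=> uv; rewrite /form23 -rmorphM uv rmorph1.
have form12M u v : curry_form u * curry_form v = 1 -> form12 u * form12 v = 1.
  by move=> uv; rewrite /form12 -rmorphM uv rmorph1.
(* The form σ(b,c) arises both from (a, b, c) and from (b, c, d); this links the two cocycle
   relations x p = y q and y r = z t. *)
have lift4_form23 u : lift4 (form23 u) = cst (form12 u).
  by rewrite /form23 convalg_map_const.
(* The letters are those of the overview; primed ones come from the convolution inverse [t] of σ.
   Forms in (a, b, c) enter through [lift4], those in (b, c, d) through [cst]. *)
apply: (@commuting_cocycle_relation _ (lift4 (form12 s)) (lift4 (form12 t))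
  (lift4 (form23 s)) _ (cst (form23 s)) (cst (form23 t)) _
  (lift4 (form1_23 s)) (cst (form12_3 s))).
- by rewrite -rmorphM form12M // rmorph1.
- by rewrite -rmorphM form12M // rmorph1.
- by rewrite -rmorphM form23M // rmorph1.
- by rewrite -rmorphM form23M // rmorph1.
- by rewrite -rmorphM form23M // rmorph1.
- by rewrite -rmorphM form23M // rmorph1.
- by rewrite -!rmorphM cocycle_relation.
- by rewrite lift4_form23 -!rmorphM cocycle_relation.
- by rewrite /GRing.comm -!rmorphM neat_relation.
- by rewrite lift4_form23 /GRing.comm -!rmorphM neat_relation.
- exact: form12_form34_comm.
- by rewrite /GRing.comm -!rmorphM lazy_relation.
- exact: neat_relation_mul2.
- exact: neat_relation_mul1.
- exact: neat_relation_mul3.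
Qed.

Lemma neat_lazy_cocycle_pure s :
  conv_invertible s -> lazy s -> cocycle2 s -> neat s -> pure s.
Proof.
move=> /conv_invP st ls cs ns a b c d.
have := congr1 (fun f : E4 => f a b c d) (pure_relation st ls cs ns).
(* Two of the three factors are ε in a, so a is not split, just as in the purity identity. *)
rewrite {1 2}/form23 convalg_map_const mulrA.
rewrite 2!convalg_constMr 2!convalg_constMl -mulrA => E.
(* Expanding the product in b and then in c gives the triple Sweedler sums; d is not split, since
   two factors are ε in it. *)
transitivity ((lift4 (form12_3 s) a * (form12 (conv_inv s) * form1_23 s)) b c d).
  rewrite convM3E !tensor_lift_conv_fun; apply: eq_tensor_lift => b1 u.
  rewrite !tensor_lift_conv_fun; apply: eq_tensor_lift => b2 b3.
  rewrite convM3E tensor_lift_conv_fun; apply: eq_tensor_lift => c1 v.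
  rewrite tensor_lift_conv_fun; apply: eq_tensor_lift => c2 c3.
  by rewrite !convalg_constMl mulrA.
rewrite [LHS]E convM3E !tensor_lift_conv_fun; apply: eq_tensor_lift => b1 u.
rewrite !tensor_lift_conv_fun; apply: eq_tensor_lift => b2 b3.
rewrite convM3E tensor_lift_conv_fun; apply: eq_tensor_lift => c1 v.
rewrite tensor_lift_conv_fun; apply: eq_tensor_lift => c2 c3.
by rewrite mulrA !convalg_constMr.
Qed.

End CocycleRelations.

Local Open Scope classical_set_scope.

Theorem proposition3p7 (k : fieldType) (H : hopfAlgType k)
    (bijS : bijective (antipode : H -> H)) :
  @Z2NL k H `<=` @Z2PL k H.
Proof.
move=> s sN.
have [sZ ns] : Z2L s /\ neat s := sN.
have [[inv _] [ls cs]] : (conv_invertible s /\ normalized s) /\ lazy s /\ cocycle2 s.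
  exact: sZ.
have ps : pure s by exact: neat_lazy_cocycle_pure.
exact: (conj sZ ps).
Qed.
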